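(* Let $q\in\mathbb C$ with $0<|q|<1$, $m\in\mathbb N_0$, and $a,t\in\mathbb C\setminus\{0\}$ with $-a,\,-qat\notin\{q^{-k}:k\in\mathbb N_0\}$. Then the $q$-Bessel polynomials $y_n(x;a;q)$ satisfy $$\sum_{n=0}^\infty\frac{t^n\,(-qa;q)_{2n}\,(-a,\frac1t;q)_n}{(-a;q)_{2n}\,(q,-qat;q)_n}\,y_n(q^m;a;q)=\frac{(-qa;q)_\infty}{(-qat;q)_\infty}\,t^m .$$
   Context: $\mathbb N_0=\{0,1,2,\dots\}$. $(a;q)_n=\prod_{j=0}^{n-1}(1-aq^j)$ for $n\in\mathbb N_0\cup\{\infty\}$, $(a_1,\dots,a_k;q)_n=\prod_i(a_i;q)_n$. The $q$-Bessel polynomials are $$y_n(x;a;q)={}_2\phi_1\left(q^{-n},-q^na;0;q,qx\right)=\sum_{k=0}^n\frac{(q^{-n},-q^na;q)_k}{(q;q)_k}(qx)^k .$$ *)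

(* Defs.v *)
From Stdlib Require Import Reals.
From Coquelicot Require Import Coquelicot.

Open Scope C_scope.

Fixpoint qpoch (a q : C) (n : nat) : C :=
  match n with
  | O => 1
  | S n' => qpoch a q n' * (1 - a * q ^ n')
  end.

(* Total: the value is meaningful only if the real and imaginary parts
   both converge; see [filterlim_Clim_seq]. *)
Definition Clim_seq (u : nat -> C) : C :=
  (real (Lim_seq (fun n => Re (u n))), real (Lim_seq (fun n => Im (u n)))).

Lemma filterlim_Clim_seq (u : nat -> C) (l : C) :
  filterlim u eventually (locally l) -> Clim_seq u = l.
Proof.
  intros H; destruct l as [x y]; unfold Clim_seq.
  f_equal.
  - assert (L : is_lim_seq (fun n => Re (u n)) x).
    { intros P [eps HP]; apply (H (fun z => P (Re z))); exists eps.
      intros z [Hz _]; apply HP, Hz. }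
    now rewrite (is_lim_seq_unique _ _ L).
  - assert (L : is_lim_seq (fun n => Im (u n)) y).
    { intros P [eps HP]; apply (H (fun z => P (Im z))); exists eps.
      intros z [_ Hz]; apply HP, Hz. }
    now rewrite (is_lim_seq_unique _ _ L).
Qed.

Definition qpoch_inf (a q : C) : C := Clim_seq (qpoch a q).

(* The series 2phi1(q^-n, -q^n a; 0; q, q x) terminates at k = n, because
   (q^-n; q)_k = 0 for k > n; the lower parameter 0 contributes
   (0; q)_k = 1. *)
Definition qBessel (n : nat) (x a q : C) : C :=
  sum_n (fun k => qpoch (/ q ^ n) q k * qpoch (- q ^ n * a) q k
                  / qpoch q q k * (q * x) ^ k) n.

(* Main.v *)
Require Import Defs.
From Stdlib Require Import Reals Lra Lia.
From Coquelicot Require Import Coquelicot.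
Open Scope C_scope.

(** Put A = - a. Multiplying the claim by (1 - A) (A q t;q)_oo turns the
    coefficient of y_n (q^m) into
    [[
      w_n (t) = (1 - A q^(2n)) (A;q)_n / (q;q)_n
                * prod_(j < n) (t - q^j) * (A q^(n+1) t;q)_oo,
    ]]
    which has no poles in t, and the claim into
    sum_n w_n (t) y_n (q^m) = (A;q)_oo t^m for all nonzero t. This is proved by
    induction on m ([weighted_series]).

    For m = 0, the q-Chu-Vandermonde sum gives y_n (1) = A^n q^(n^2)
    ([qBessel_at_1]), and the claim is a limiting case of the very-well-poised
    6phi5 sum. Its summand satisfies a first-order recurrence under A -> A q up
    to an explicit difference ([base_term_telescope]), so the sum E (A) satisfies
    E (A) = (1 - A) E (A q). Iterating and letting A q^k tend to 0, where only
    the term n = 0 survives, gives E (A) = (A;q)_oo ([base_sum_eq]).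

    For the step, y_n satisfies a second-order q-difference equation in x in
    which n enters only through the eigenvalue q^(-n) + a - 1 - a q^n
    ([qBessel_qdiff]). Multiplication of w_n (t) by that same eigenvalue is
    expressed by the shift t -> t/q ([weight_shift]). Hence the terms at q^(m+1)
    are a fixed linear combination of the terms at q^m, taken at t and at t/q,
    and of those at q^(m-1); the last have the coefficient 1 - q^m, which
    vanishes for m = 0. Both convergence and the value t^(m+1) follow by
    linearity ([weighted_series_step]), so estimates are needed only for
    m = 0, where q^(n^2) dominates. *)

(** * Limits and series of complex numbers *)

(** Reduces complex limits to real ones, for which squeeze arguments exist. *)
Lemma filterlim_C_iff (u : nat -> C) (l : C) :
  filterlim u eventually (locally (T := C_NormedModule) l)
  <-> is_lim_seq (fun n => Cmod (u n - l)) 0%R.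
Proof.
  split.
  - intros H. apply is_lim_seq_spec; intros eps.
    apply (proj1 (filterlim_locally_ball_norm (U := C_NormedModule) u l)) with (eps := eps) in H.
    revert H; apply filter_imp; intros n Hn.
    rewrite Rminus_0_r, Rabs_pos_eq by apply Cmod_ge_0. exact Hn.
  - intros H. apply filterlim_locally_ball_norm; intros eps.
    apply is_lim_seq_spec in H. specialize (H eps).
    revert H; apply filter_imp; intros n Hn.
    rewrite Rminus_0_r, Rabs_pos_eq in Hn by apply Cmod_ge_0. exact Hn.
Qed.

Lemma filterlim_C_unique (u : nat -> C) (l l' : C) :
  filterlim u eventually (locally (T := C_NormedModule) l) ->
  filterlim u eventually (locally (T := C_NormedModule) l') -> l = l'.
Proof.
  intros H H'.
  exact (filterlim_locally_unique (V := C_NormedModule) u l l' H H').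
Qed.

Lemma exp_le_compat (x y : R) : (x <= y -> exp x <= exp y)%R.
Proof.
  intros [H | ->]; [now apply Rlt_le, exp_increasing | apply Rle_refl].
Qed.

Lemma Cmod_minus_le (x y : C) : (Cmod (x - y) <= Cmod x + Cmod y)%R.
Proof.
  unfold Cminus; eapply Rle_trans; [apply Cmod_triangle|].
  rewrite Cmod_opp; apply Rle_refl.
Qed.

Lemma filterlim_C_mult_l (c l : C) (u : nat -> C) :
  filterlim u eventually (locally (T := C_NormedModule) l) ->
  filterlim (fun n => c * u n) eventually (locally (T := C_NormedModule) (c * l)).
Proof.
  intros H; apply filterlim_C_iff in H; apply filterlim_C_iff.
  apply (is_lim_seq_scal_l _ (Cmod c)) in H.
  replace (Rbar_mult (Cmod c) 0%R) with (Finite 0) in H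
    by (simpl; f_equal; ring).
  revert H; apply is_lim_seq_ext; intros n.
  rewrite <- Cmod_mult; f_equal; ring.
Qed.

Lemma filterlim_C_sub (u v : nat -> C) (l m : C) :
  filterlim u eventually (locally (T := C_NormedModule) l) ->
  filterlim v eventually (locally (T := C_NormedModule) m) ->
  filterlim (fun n => u n - v n) eventually (locally (T := C_NormedModule) (l - m)).
Proof.
  intros Hu Hv. apply filterlim_C_iff in Hu, Hv. apply filterlim_C_iff.
  apply is_lim_seq_le_le with (fun _ => 0%R) (fun n => (Cmod (u n - l) + Cmod (v n - m))%R).
  - intros n; split; [apply Cmod_ge_0|].
    replace (u n - v n - (l - m)) with ((u n - l) - (v n - m)) by ring.
    apply Cmod_minus_le.
  - apply is_lim_seq_const.
  - replace (Finite 0) with (Finite (0 + 0)) by (f_equal; ring).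
    now apply is_lim_seq_plus'.
Qed.

Lemma Cmod_lim_le (u : nat -> C) (l : C) (B : R) :
  (forall n, Cmod (u n) <= B)%R ->
  filterlim u eventually (locally (T := C_NormedModule) l) -> (Cmod l <= B)%R.
Proof.
  intros HB H. apply filterlim_C_iff in H.
  apply (is_lim_seq_le (fun _ => Cmod l) (fun n => (Cmod (u n - l) + B)%R) (Cmod l) B).
  - intros n. replace l with (- (u n - l) + u n) at 1 by ring.
    eapply Rle_trans; [apply Cmod_triangle|]. rewrite Cmod_opp.
    apply Rplus_le_compat_l, HB.
  - apply is_lim_seq_const.
  - replace (Finite B) with (Finite (0 + B)) by (f_equal; ring).
    apply is_lim_seq_plus'; [assumption|apply is_lim_seq_const].
Qed.

Lemma Re_sum_n (a : nat -> C) n : Re (sum_n a n) = sum_n (fun k => Re (a k)) n.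
Proof.
  induction n as [|n IH]; [now rewrite !sum_O|].
  rewrite !sum_Sn, <- IH. reflexivity.
Qed.

Lemma Im_sum_n (a : nat -> C) n : Im (sum_n a n) = sum_n (fun k => Im (a k)) n.
Proof.
  induction n as [|n IH]; [now rewrite !sum_O|].
  rewrite !sum_Sn, <- IH. reflexivity.
Qed.

Lemma im_le_Cmod (c : C) : (Rabs (Im c) <= Cmod c)%R.
Proof. eapply Rle_trans; [|apply Rmax_Cmod]; apply Rmax_r. Qed.

Lemma Cmod_le_Re_Im (c : C) : (Cmod c <= Rabs (Re c) + Rabs (Im c))%R.
Proof.
  replace c with (RtoC (Re c) + Ci * RtoC (Im c)) at 1.
  - eapply Rle_trans; [apply Cmod_triangle|].
    rewrite Cmod_mult, Cmod_Ci, !Cmod_R; lra.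
  - destruct c as [x y]; unfold Ci, RtoC, Cplus, Cmult; simpl; f_equal; ring.
Qed.

Lemma ex_series_Cmod (a : nat -> C) (b : nat -> R) :
  (forall n, Cmod (a n) <= b n)%R -> ex_series b ->
  ex_series (V := C_NormedModule) a.
Proof.
  intros Hab Hb.
  destruct (ex_series_le (V := R_CompleteNormedModule) (fun n => Re (a n)) b) as [x Hx]; trivial.
  { intros n. eapply Rle_trans; [|apply Hab]. apply re_le_Cmod. }
  destruct (ex_series_le (V := R_CompleteNormedModule) (fun n => Im (a n)) b) as [y Hy]; trivial.
  { intros n. eapply Rle_trans; [|apply Hab]. apply im_le_Cmod. }
  exists (x, y). apply filterlim_C_iff.
  apply is_lim_seq_le_le with (u := fun _ => 0%R)
    (w := fun n => (Rabs (sum_n (fun k => Re (a k)) n - x)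
                    + Rabs (sum_n (fun k => Im (a k)) n - y))%R).
  - intros n; split; [apply Cmod_ge_0|].
    rewrite <- Re_sum_n, <- Im_sum_n. apply Cmod_le_Re_Im.
  - apply is_lim_seq_const.
  - replace (Finite 0) with (Finite (Rabs (x - x) + Rabs (y - y))).
    + apply is_lim_seq_plus'; apply is_lim_seq_abs with (l := Finite _);
        apply is_lim_seq_minus'; try apply is_lim_seq_const; assumption.
    + f_equal; rewrite !Rminus_diag, Rabs_R0; ring.
Qed.

Lemma Cmod_series_le (a : nat -> C) (l : C) (b : nat -> R) (B : R) :
  (forall n, Cmod (a n) <= b n)%R ->
  is_series (V := C_NormedModule) a l -> is_series b B -> (Cmod l <= B)%R.
Proof.
  intros Hab Ha Hb.
  assert (Hs : forall n, (Cmod (sum_n a n) <= sum_n b n)%R).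
  { induction n as [|n IH]; [rewrite !sum_O; apply Hab|].
    rewrite !sum_Sn. eapply Rle_trans; [apply Cmod_triangle|].
    apply Rplus_le_compat; [exact IH|apply Hab]. }
  apply filterlim_C_iff in Ha.
  apply (is_lim_seq_le (fun _ => Cmod l)
           (fun n => (Cmod (sum_n a n - l) + sum_n b n)%R) (Cmod l) B).
  - intros n. replace l with (- (sum_n a n - l) + sum_n a n) at 1 by ring.
    eapply Rle_trans; [apply Cmod_triangle|]. rewrite Cmod_opp.
    apply Rplus_le_compat_l, Hs.
  - apply is_lim_seq_const.
  - replace B with (0 + B)%R by ring. now apply is_lim_seq_plus'.
Qed.

Lemma is_series_C_ext (u v : nat -> C) (l : C) :
  (forall n, u n = v n) ->
  is_series (V := C_NormedModule) u l -> is_series (V := C_NormedModule) v l.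
Proof. exact (is_series_ext (V := C_NormedModule) u v l). Qed.

Lemma is_series_C_lin3 (u v w : nat -> C) (a b c lu lv lw : C) :
  is_series (V := C_NormedModule) u lu -> is_series (V := C_NormedModule) v lv ->
  is_series (V := C_NormedModule) w lw ->
  is_series (V := C_NormedModule) (fun n => a * u n + b * v n + c * w n)
    (a * lu + b * lv + c * lw).
Proof.
  intros Hu Hv Hw.
  apply (is_series_plus (V := C_NormedModule) (fun n => a * u n + b * v n)
           (fun n => c * w n) (a * lu + b * lv) (c * lw)).
  - apply (is_series_plus (V := C_NormedModule) (fun n => a * u n)
             (fun n => b * v n) (a * lu) (b * lv));
      now apply (is_series_scal (V := C_NormedModule)).
  - now apply (is_series_scal (V := C_NormedModule)).
Qed.

Lemma Cmod_pow_le1 (q : C) n : (Cmod q < 1)%R -> (Cmod (q ^ n) <= 1)%R.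
Proof.
  intros hq; rewrite Cmod_pow, <- (pow1 n).
  apply pow_incr; split; [apply Cmod_ge_0|lra].
Qed.

Lemma Cmod_geom_lim (a q : C) : (Cmod q < 1)%R ->
  is_lim_seq (fun k => Cmod (a * q ^ k)) 0%R.
Proof.
  intros hq. apply is_lim_seq_ext with (fun k => (Cmod a * Cmod q ^ k)%R).
  - intros k; now rewrite Cmod_mult, Cmod_pow.
  - replace (Finite 0) with (Rbar_mult (Cmod a) 0%R) by (simpl; f_equal; ring).
    apply is_lim_seq_scal_l, is_lim_seq_geom.
    rewrite Rabs_pos_eq; [assumption|apply Cmod_ge_0].
Qed.

(** The series of x^n r^(n^2), a form of theta series: eventually x r^n is at
    most 1/2, so a geometric series dominates. *)
Lemma ex_series_gauss (x r : R) : (0 <= x)%R -> (0 <= r < 1)%R ->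
  ex_series (fun n => (x * r ^ n) ^ n)%R.
Proof.
  intros x0 r01.
  assert (L : is_lim_seq (fun n => x * r ^ n)%R 0%R).
  { replace (Finite 0) with (Rbar_mult x 0%R) by (simpl; f_equal; ring).
    apply is_lim_seq_scal_l, is_lim_seq_geom. rewrite Rabs_pos_eq; lra. }
  apply is_lim_seq_spec in L.
  destruct (L (mkposreal (/ 2) ltac:(lra))) as [N HN]; simpl in HN.
  apply (ex_series_incr_n _ N).
  apply (ex_series_le (V := R_CompleteNormedModule))
    with (fun n => (/ 2) ^ n)%R.
  2: { apply ex_series_geom. rewrite Rabs_pos_eq; lra. }
  intros n. set (k := (N + n)%nat).
  assert (Hk : (0 <= x * r ^ k)%R).
  { apply Rmult_le_pos; [exact x0|apply pow_le; lra]. }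
  assert (Hk2 : (x * r ^ k <= / 2)%R).
  { assert (H := HN k ltac:(lia)).
    rewrite Rminus_0_r, Rabs_pos_eq in H; lra. }
  change (Rabs ((x * r ^ k) ^ k) <= (/ 2) ^ n)%R.
  rewrite Rabs_pos_eq by now apply pow_le.
  apply Rle_trans with ((/ 2) ^ k)%R; [apply pow_incr; lra|].
  unfold k; rewrite pow_add. rewrite <- (Rmult_1_l ((/ 2) ^ n)) at 2.
  apply Rmult_le_compat_r; [apply pow_le; lra|].
  rewrite <- (pow1 N); apply pow_incr; lra.
Qed.

(** * Finite and infinite q-shifted factorials *)

Lemma qpoch_S a q n : qpoch a q (S n) = qpoch a q n * (1 - a * q ^ n).
Proof. reflexivity. Qed.

Lemma qpoch_shift a q n : qpoch a q (S n) = (1 - a) * qpoch (a * q) q n.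
Proof.
  induction n as [|n IH]; [simpl; ring|].
  rewrite qpoch_S, IH, qpoch_S, Cpow_S. ring.
Qed.

(** From |1 - a q^j| <= 1 + |a| |q|^j <= exp (|a| |q|^j), the geometric sum
    of the exponents being bounded independently of n. *)
Lemma qpoch_bound a q n : (Cmod q < 1)%R ->
  (Cmod (qpoch a q n) <= exp (Cmod a / (1 - Cmod q)))%R.
Proof.
  intros hq. set (r := Cmod q) in *.
  assert (r0 : (0 <= r)%R) by apply Cmod_ge_0.
  assert (a0 := Cmod_ge_0 a).
  assert (H : (Cmod (qpoch a q n) <= exp (Cmod a * ((1 - r ^ n) / (1 - r))))%R).
  { induction n as [|n IH].
    - simpl. rewrite Cmod_1. replace (_ * _)%R with 0%R by (field; lra).
      rewrite exp_0; lra.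
    - rewrite qpoch_S, Cmod_mult.
      replace (Cmod a * ((1 - r ^ S n) / (1 - r)))%R
        with (Cmod a * ((1 - r ^ n) / (1 - r)) + Cmod a * r ^ n)%R
        by (simpl; field; lra).
      rewrite exp_plus.
      apply Rmult_le_compat; try apply Cmod_ge_0; [exact IH|].
      apply Rle_trans with (1 + Cmod a * r ^ n)%R; [|apply exp_ineq1_le].
      unfold Cminus. eapply Rle_trans; [apply Cmod_triangle|].
      rewrite Cmod_opp, Cmod_1, Cmod_mult, Cmod_pow. fold r. lra. }
  eapply Rle_trans; [exact H|].
  assert (Hn : (0 <= r ^ n)%R) by now apply pow_le.
  assert (Hi : (0 < / (1 - r))%R) by (apply Rinv_0_lt_compat; lra).
  apply exp_le_compat. unfold Rdiv. apply Rmult_le_compat_l; [lra|].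
  rewrite <- (Rmult_1_l (/ (1 - r))) at 2. apply Rmult_le_compat_r; lra.
Qed.

(** The increments of the partial products are - a q^n (a;q)_n, so they are
    dominated by a geometric series of size |a|; hence the infinite product
    tends to 1 with its argument. *)
Lemma qpoch_sub1_bound a q n : (Cmod q < 1)%R ->
  (Cmod (qpoch a q n - 1)
   <= Cmod a * (exp (Cmod a / (1 - Cmod q)) / (1 - Cmod q)))%R.
Proof.
  intros hq. set (r := Cmod q) in *. set (M := exp (Cmod a / (1 - r))).
  assert (r0 : (0 <= r)%R) by apply Cmod_ge_0.
  assert (a0 := Cmod_ge_0 a).
  assert (M0 : (0 < M)%R) by apply exp_pos.
  assert (H : (Cmod (qpoch a q n - 1) <= Cmod a * M * ((1 - r ^ n) / (1 - r)))%R).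
  { induction n as [|n IH].
    - simpl. replace (1 - 1) with (RtoC 0) by ring. rewrite Cmod_0.
      apply Req_le; field; lra.
    - replace (qpoch a q (S n) - 1)
        with ((qpoch a q n - 1) + - (qpoch a q n * (a * q ^ n)))
        by (rewrite qpoch_S; ring).
      eapply Rle_trans; [apply Cmod_triangle|].
      rewrite Cmod_opp, !Cmod_mult, Cmod_pow. fold r.
      replace (Cmod a * M * ((1 - r ^ S n) / (1 - r)))%R
        with (Cmod a * M * ((1 - r ^ n) / (1 - r)) + M * (Cmod a * r ^ n))%R
        by (simpl; field; lra).
      apply Rplus_le_compat; [exact IH|].
      apply Rmult_le_compat_r; [|now apply qpoch_bound].
      apply Rmult_le_pos; [lra|now apply pow_le]. }
  eapply Rle_trans; [exact H|].
  assert (Hn : (0 <= r ^ n)%R) by now apply pow_le.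
  assert (Hi : (0 < / (1 - r))%R) by (apply Rinv_0_lt_compat; lra).
  unfold Rdiv. rewrite Rmult_assoc. apply Rmult_le_compat_l; [lra|].
  apply Rmult_le_compat_l; [lra|].
  rewrite <- (Rmult_1_l (/ (1 - r))) at 2. apply Rmult_le_compat_r; lra.
Qed.

(** The increments of the partial products form an absolutely convergent
    series. *)
Lemma qpoch_cvg a q : (Cmod q < 1)%R ->
  filterlim (qpoch a q) eventually (locally (T := C_NormedModule) (qpoch_inf a q)).
Proof.
  intros hq. set (r := Cmod q). set (M := exp (Cmod a / (1 - r))).
  assert (r0 : (0 <= r)%R) by apply Cmod_ge_0.
  destruct (ex_series_Cmod (fun n => - (qpoch a q n * (a * q ^ n)))
              (fun n => (M * Cmod a * r ^ n)%R)) as [s Hs].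
  { intros n. rewrite Cmod_opp, !Cmod_mult, Cmod_pow, Rmult_assoc.
    apply Rmult_le_compat_r; [|now apply qpoch_bound].
    apply Rmult_le_pos; [apply Cmod_ge_0|now apply pow_le]. }
  { apply ex_series_ext with (fun n => scal (M * Cmod a)%R (r ^ n)%R);
      [reflexivity|].
    apply (ex_series_scal (V := R_NormedModule)), ex_series_geom.
    rewrite Rabs_pos_eq; assumption. }
  assert (Hsum : forall n, sum_n (fun n => - (qpoch a q n * (a * q ^ n))) n
                           = qpoch a q (S n) - 1 :> C).
  { induction n as [|n IH]; [rewrite sum_O; simpl; ring|].
    rewrite sum_Sn, IH, (qpoch_S a q (S n)).
    change plus with Cplus. ring. }
  assert (Hl : filterlim (qpoch a q) eventually
                 (locally (T := C_NormedModule) (s + 1))).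
  { apply filterlim_C_iff, is_lim_seq_incr_1.
    apply filterlim_C_iff in Hs. revert Hs. apply is_lim_seq_ext; intros n.
    rewrite Hsum. f_equal; ring. }
  unfold qpoch_inf. now rewrite (filterlim_Clim_seq _ _ Hl).
Qed.

Lemma qpoch_inf_shift a q : (Cmod q < 1)%R ->
  qpoch_inf a q = (1 - a) * qpoch_inf (a * q) q.
Proof.
  intros hq. apply (filterlim_C_unique (fun n => qpoch a q (S n))).
  - apply filterlim_C_iff.
    apply is_lim_seq_incr_1 with (u := fun n => Cmod (qpoch a q n - qpoch_inf a q)).
    now apply filterlim_C_iff, qpoch_cvg.
  - apply filterlim_ext with (fun n => (1 - a) * qpoch (a * q) q n).
    + intros n; now rewrite qpoch_shift.
    + now apply filterlim_C_mult_l, qpoch_cvg.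
Qed.

Lemma qpoch_inf_split a q n : (Cmod q < 1)%R ->
  qpoch_inf a q = qpoch a q n * qpoch_inf (a * q ^ n) q.
Proof.
  intros hq. induction n as [|n IH].
  - simpl. rewrite Cmult_1_r, Cmult_1_l; reflexivity.
  - rewrite IH, (qpoch_inf_shift (a * q ^ n)), qpoch_S by assumption.
    rewrite Cpow_S. replace (a * (q * q ^ n)) with (a * q ^ n * q) by ring. ring.
Qed.

Lemma qpoch_inf_bound a q : (Cmod q < 1)%R ->
  (Cmod (qpoch_inf a q) <= exp (Cmod a / (1 - Cmod q)))%R.
Proof.
  intros hq. apply Cmod_lim_le with (qpoch a q).
  - intros n; now apply qpoch_bound.
  - now apply qpoch_cvg.
Qed.

Lemma qpoch_inf_sub1_bound a q : (Cmod q < 1)%R ->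
  (Cmod (qpoch_inf a q - 1)
   <= Cmod a * (exp (Cmod a / (1 - Cmod q)) / (1 - Cmod q)))%R.
Proof.
  intros hq. apply Cmod_lim_le with (fun n => qpoch a q n - 1).
  - intros n; now apply qpoch_sub1_bound.
  - apply filterlim_C_iff.
    generalize (proj1 (filterlim_C_iff _ _) (qpoch_cvg a q hq)).
    apply is_lim_seq_ext; intros n; f_equal; ring.
Qed.

Lemma qpoch_inf_geom_lim a q : (Cmod q < 1)%R ->
  filterlim (fun k => qpoch_inf (a * q ^ k) q) eventually
    (locally (T := C_NormedModule) (RtoC 1)).
Proof.
  intros hq. apply filterlim_C_iff.
  set (M := (exp (Cmod a / (1 - Cmod q)) / (1 - Cmod q))%R).
  assert (Hi : (0 < / (1 - Cmod q))%R) by (apply Rinv_0_lt_compat; lra).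
  apply is_lim_seq_le_le with (fun _ => 0%R) (fun k => (Cmod (a * q ^ k) * M)%R).
  - intros k; split; [apply Cmod_ge_0|].
    eapply Rle_trans; [now apply qpoch_inf_sub1_bound|].
    apply Rmult_le_compat_l; [apply Cmod_ge_0|]. unfold M, Rdiv.
    apply Rmult_le_compat_r; [lra|]. apply exp_le_compat.
    apply Rmult_le_compat_r; [lra|]. rewrite Cmod_mult, Cmod_pow.
    rewrite <- (Rmult_1_r (Cmod a)) at 2.
    apply Rmult_le_compat_l; [apply Cmod_ge_0|].
    assert (H := Cmod_ge_0 q).
    rewrite <- (pow1 k). apply pow_incr; lra.
  - apply is_lim_seq_const.
  - replace (Finite 0) with (Rbar_mult 0%R M) by (simpl; f_equal; ring).
    apply is_lim_seq_scal_r, Cmod_geom_lim, hq.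
Qed.

Lemma qpoch_neq0 a q n : (forall k, 1 - a * q ^ k <> 0) -> qpoch a q n <> 0.
Proof.
  intros H; induction n as [|n IH]; [exact C1_nz|].
  rewrite qpoch_S; now apply Cmult_neq_0.
Qed.

(** If the product vanished, then, its leading factors being nonzero, so would
    all its tails (a q^k; q)_oo, but these tend to 1. *)
Lemma qpoch_inf_neq0 a q : (Cmod q < 1)%R ->
  (forall k, 1 - a * q ^ k <> 0) -> qpoch_inf a q <> 0.
Proof.
  intros hq Ha H0.
  assert (Hz : forall k, qpoch_inf (a * q ^ k) q = 0).
  { intros k. rewrite (qpoch_inf_split a q k hq) in H0.
    destruct (Ceq_dec (qpoch_inf (a * q ^ k) q) 0) as [E|E]; [exact E|].
    exfalso; revert H0; apply Cmult_neq_0; [now apply qpoch_neq0|exact E]. }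
  apply C1_nz. apply (filterlim_C_unique (fun k => qpoch_inf (a * q ^ k) q)).
  - now apply qpoch_inf_geom_lim.
  - apply filterlim_ext with (fun _ => RtoC 0); [now intros; rewrite Hz|].
    apply filterlim_const.
Qed.

Lemma one_sub_qpow_neq0 (q : C) (k : nat) : (Cmod q < 1)%R -> 1 - q * q ^ k <> 0.
Proof.
  intros hq H.
  assert (H1 : q ^ S k = 1).
  { rewrite Cpow_S. replace (q * q ^ k) with (1 - (1 - q * q ^ k)) by ring.
    rewrite H; ring. }
  apply (f_equal Cmod) in H1. rewrite Cmod_pow, Cmod_1 in H1.
  assert (H2 : (Cmod q ^ S k < 1)%R).
  { apply pow_lt_1_compat; [split; [apply Cmod_ge_0|exact hq]|lia]. }
  lra.
Qed.

Lemma qpoch_qq_neq0 (q : C) (n : nat) : (Cmod q < 1)%R -> qpoch q q n <> 0.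
Proof. intros hq; apply qpoch_neq0; intros k; now apply one_sub_qpow_neq0. Qed.

Lemma qpoch_qq_lower q n : (Cmod q < 1)%R ->
  ((1 - Cmod q) ^ n <= Cmod (qpoch q q n))%R.
Proof.
  intros hq; induction n as [|n IH]; [simpl; rewrite Cmod_1; lra|].
  simpl. rewrite Cmod_mult, Rmult_comm.
  assert (H0 := Cmod_ge_0 q).
  apply Rmult_le_compat; [apply pow_le; lra|lra|exact IH|].
  assert (H : (Cmod (q * q ^ n) <= Cmod q)%R).
  { rewrite Cmod_mult. rewrite <- (Rmult_1_r (Cmod q)) at 2.
    apply Rmult_le_compat_l; [exact H0|now apply Cmod_pow_le1]. }
  assert (H1 := Cmod_triangle (1 - q * q ^ n) (q * q ^ n)).
  replace (1 - q * q ^ n + q * q ^ n) with (RtoC 1) in H1 by ring.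
  rewrite Cmod_1 in H1. lra.
Qed.

(** * The q-Bessel polynomials: value at 1 and q-difference equation *)

(** Partial sums of 2phi1 (c, d; 0; q, q x). Keeping c, d and the cut-off N
    free makes the identities below provable by induction on N. *)
Definition phi21_partial (c d q x : C) (N : nat) : C :=
  sum_n (fun k => qpoch c q k * qpoch d q k / qpoch q q k * (q * x) ^ k) N.

Lemma phi21_partial_O c d q x : phi21_partial c d q x 0 = 1.
Proof.
  unfold phi21_partial; rewrite sum_O; simpl; field; exact C1_nz.
Qed.

Lemma phi21_partial_S c d q x N :
  phi21_partial c d q x (S N)
  = phi21_partial c d q x N
    + qpoch c q (S N) * qpoch d q (S N) / qpoch q q (S N) * (q * x) ^ S N.
Proof. unfold phi21_partial; now rewrite sum_Sn. Qed.

(** Termwise, from (d;q)_(k+1) - (d q;q)_(k+1) = - d (1 - q^(k+1)) (d q;q)_k,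
    whose last factor cancels in (q;q)_(k+1). *)
Lemma phi21_partial_contiguous d b q N : (Cmod q < 1)%R ->
  phi21_partial d b q 1 (S N)
  = phi21_partial (d * q) b q 1 (S N)
    - d * q * (1 - b) * phi21_partial (d * q) (b * q) q 1 N.
Proof.
  intros hq. induction N as [|N IH].
  - rewrite !phi21_partial_S, !phi21_partial_O. simpl.
    assert (H := one_sub_qpow_neq0 q 0 hq); simpl in H; rewrite Cmult_1_r in H. field. exact H.
  - rewrite (phi21_partial_S d), (phi21_partial_S _ b q 1 (S N)), IH,
      (phi21_partial_S _ (b * q)).
    rewrite (qpoch_shift d), (qpoch_shift b), (qpoch_S (d * q) q (S N)),
      (qpoch_S q q (S N)), (Cpow_S (q * 1) (S N)), !Cmult_1_r.
    assert (H := qpoch_qq_neq0 q (S N) hq).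
    assert (H' := one_sub_qpow_neq0 q (S N) hq).
    rewrite (Cpow_S q) in H' |- *. field. tauto.
Qed.

(** The q-Chu-Vandermonde sum with lower parameter 0. The contiguous relation
    gives s_(n+1) (b) = s_n (b) - q^(-n) (1 - b) s_n (b q), that is,
    b^n - (1 - b) b^n. *)
Lemma q_chu_vandermonde q (n : nat) : (0 < Cmod q < 1)%R ->
  forall b N, (n <= N)%nat -> phi21_partial (/ q ^ n) b q 1 N = b ^ n.
Proof.
  intros [q0 hq]. assert (hq0 : q <> 0) by now apply Cmod_gt_0.
  induction n as [|n IH]; intros b N HN.
  - induction N as [|N IHN]; [apply phi21_partial_O|].
    rewrite phi21_partial_S, IHN, qpoch_shift by lia.
    simpl. replace (/ 1) with (RtoC 1) by (field; exact C1_nz).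
    unfold Cdiv. ring.
  - destruct N as [|N]; [lia|].
    rewrite phi21_partial_contiguous by assumption.
    assert (Hn := Cpow_nz q n hq0).
    replace (/ q ^ S n * q) with (/ q ^ n) by (rewrite Cpow_S; field; tauto).
    rewrite !IH by lia. rewrite Cpow_mult_l, Cpow_S. field; tauto.
Qed.

(** The q-difference equation in x of 2phi1 (c, d; 0; q, q x) holds for the
    partial sums up to a boundary term, because the coefficients of equal
    powers of x telescope; the boundary term contains (c;q)_(N+1), which
    vanishes when c = q^(-N). *)
Lemma phi21_partial_qdiff c d q x N : (0 < Cmod q < 1)%R ->
  - ((1 - c) * (1 - d)) * x * phi21_partial c d q x N
  - c * d * x * phi21_partial c d q (q * x) N
  - (1 - x - c * d * x) * phi21_partial c d q x N
  + (1 - x) * phi21_partial c d q (x / q) N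
  = - (qpoch c q (S N) * qpoch d q (S N) / qpoch q q N * (q * x) ^ N
       * (x / q ^ N)).
Proof.
  intros [q0 hq]. assert (hq0 : q <> 0) by now apply Cmod_gt_0.
  replace (q * (x / q)) with x by (field; exact hq0).
  induction N as [|N IH].
  - rewrite !phi21_partial_O. simpl. field.
  - rewrite !phi21_partial_S.
    set (R := - (qpoch c q (S N) * qpoch d q (S N) / qpoch q q N
                 * (q * x) ^ N * (x / q ^ N))) in *.
    transitivity (R
      + qpoch c q (S N) * qpoch d q (S N) / qpoch q q (S N)
        * (- ((1 - c) * (1 - d)) * x * (q * x) ^ S N
           - c * d * x * (q * (q * x)) ^ S N
           - (1 - x - c * d * x) * (q * x) ^ S N
           + (1 - x) * (q * (x / q)) ^ S N)).
    { rewrite <- IH. ring. }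
    unfold R.
    rewrite (qpoch_S c q (S N)), (qpoch_S d q (S N)), (qpoch_S q q N).
    replace (q * (x / q)) with x by (field; exact hq0).
    rewrite !Cpow_mult_l, !Cpow_S.
    assert (H := qpoch_qq_neq0 q N hq).
    assert (H' := one_sub_qpow_neq0 q N hq).
    assert (Hn := Cpow_nz q N hq0).
    field. tauto.
Qed.

Lemma qBessel_at_1 n a q : (0 < Cmod q < 1)%R ->
  qBessel n 1 a q = (- q ^ n * a) ^ n.
Proof. intros hq; now apply q_chu_vandermonde. Qed.

Lemma qpoch_inv_pow_vanish (q : C) n : q <> 0 -> qpoch (/ q ^ n) q (S n) = 0.
Proof.
  intros hq0. rewrite qpoch_S. rewrite Cinv_l by (apply Cpow_nz; exact hq0). ring.
Qed.

(** The eigenvalue q^(-n) + a - 1 - a q^n multiplying x is the only place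
    where n enters. *)
Lemma qBessel_qdiff n x a q : (0 < Cmod q < 1)%R ->
  a * x * qBessel n (q * x) a q
  = (a * x + 1 - x - (/ q ^ n + a - 1 - a * q ^ n) * x) * qBessel n x a q
    - (1 - x) * qBessel n (x / q) a q.
Proof.
  intros hq. assert (hq0 : q <> 0) by now apply Cmod_gt_0.
  assert (Hn := Cpow_nz q n hq0).
  assert (H := phi21_partial_qdiff (/ q ^ n) (- q ^ n * a) q x n hq).
  rewrite qpoch_inv_pow_vanish in H by assumption.
  (* c d = - a, and (1 - c) (1 - d) is minus the eigenvalue *)
  change (qBessel n) with
    (fun x a q => phi21_partial (/ q ^ n) (- q ^ n * a) q x n); cbv beta.
  set (y0 := phi21_partial _ _ _ (q * x) _) in *.
  set (y1 := phi21_partial _ _ _ x _) in *.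
  set (y2 := phi21_partial _ _ _ (x / q) _) in *.
  match type of H with ?l = ?r =>
    transitivity (a * x * y0 - (l - r)); [rewrite H; ring|] end.
  unfold Cdiv. field. split; [exact Hn|now apply qpoch_qq_neq0].
Qed.

(** * The coefficients of the expansion *)

(** This is t^n (1/t;q)_n written as a polynomial in t, with zeros at the
    points 1, q, ..., q^(n-1). *)
Fixpoint node_prod (t q : C) (n : nat) : C :=
  match n with
  | O => 1
  | S n' => node_prod t q n' * (t - q ^ n')
  end.

Lemma node_prod_qpoch (t q : C) n : t <> 0 ->
  t ^ n * qpoch (1 / t) q n = node_prod t q n.
Proof.
  intros ht; induction n as [|n IH]; [simpl; ring|].
  simpl node_prod. rewrite <- IH, qpoch_S, Cpow_S. field. exact ht.
Qed.

(** Replacing t by t/q moves the zeros to q, ..., q^n, up to the factor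
    q^(-n). *)
Lemma node_prod_shift (t q : C) n : q <> 0 ->
  (t - 1) * node_prod (t / q) q n = (t - q ^ n) / q ^ n * node_prod t q n.
Proof.
  intros hq; induction n as [|n IH]; [simpl; field|].
  simpl node_prod.
  replace ((t - 1) * (node_prod (t / q) q n * (t / q - q ^ n)))
    with ((t - 1) * node_prod (t / q) q n * (t / q - q ^ n)) by ring.
  rewrite IH, Cpow_S. field. split; [now apply Cpow_nz|exact hq].
Qed.

Lemma node_prod_bound t q n : (Cmod q < 1)%R ->
  (Cmod (node_prod t q n) <= (1 + Cmod t) ^ n)%R.
Proof.
  intros hq; induction n as [|n IH]; [simpl; rewrite Cmod_1; lra|].
  simpl. rewrite Cmod_mult, Rmult_comm.
  apply Rmult_le_compat; try apply Cmod_ge_0; [|exact IH].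
  eapply Rle_trans; [apply Cmod_minus_le|].
  assert (H := Cmod_pow_le1 q n hq). lra.
Qed.

(** With A = - a, this is (1 - A) (A q t;q)_oo times the coefficient of
    y_n in the theorem. Multiplying by the infinite product turns
    1 / (A q t;q)_n into (A q^(n+1) t;q)_oo, so that no value of t is
    exceptional and t may be replaced by t/q freely. *)
Definition weight (A q t : C) (n : nat) : C :=
  (1 - A * q ^ (2 * n)) * (qpoch A q n / qpoch q q n * node_prod t q n
    * qpoch_inf (A * q ^ S n * t) q).

(** Since (t - q^n) (1 + a q^n t) / q^n is t times the eigenvalue in
    [qBessel_qdiff] plus a quantity free of n, for A = - a, multiplication
    of the coefficients by that eigenvalue amounts to the shift of t to t/q. *)
Lemma weight_shift (A q t : C) n : (0 < Cmod q < 1)%R ->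
  (t - 1) * weight A q (t / q) n
  = (t - q ^ n) / q ^ n * (1 - A * q ^ n * t) * weight A q t n.
Proof.
  intros [q0 hq]. assert (hq0 : q <> 0) by now apply Cmod_gt_0.
  assert (H := node_prod_shift t q n hq0). unfold weight.
  replace (A * q ^ S n * (t / q)) with (A * q ^ n * t)
    by (rewrite Cpow_S; field; exact hq0).
  rewrite (qpoch_inf_shift (A * q ^ n * t)) by exact hq.
  replace (A * q ^ n * t * q) with (A * q ^ S n * t) by (rewrite Cpow_S; ring).
  set (L := qpoch_inf _ _).
  transitivity ((1 - A * q ^ (2 * n)) * (qpoch A q n / qpoch q q n
    * ((t - 1) * node_prod (t / q) q n) * ((1 - A * q ^ n * t) * L))); [ring|].
  rewrite H. ring.
Qed.

(** * The case m = 0: a very-well-poised sum *)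

(** The summand for m = 0 without its factor 1 - A q^(2n); the last power
    is A^n q^(n^2), the value of y_n at 1. *)
Definition bare_term (A q t : C) (n : nat) : C :=
  qpoch A q n / qpoch q q n * node_prod t q n
  * qpoch_inf (A * q ^ S n * t) q * (A * q ^ n) ^ n.

(** The radius |B| controls the slowly varying factors while the decay is kept
    in |A|: taking B fixed and A small makes the bound small. *)
Definition bare_term_bound (B q t : C) (A : C) (n : nat) : R :=
  (exp (Cmod B / (1 - Cmod q)) * exp (Cmod B * Cmod t / (1 - Cmod q))
   * ((1 + Cmod t) / (1 - Cmod q) * Cmod A * Cmod q ^ n) ^ n)%R.

Lemma bare_term_le (A B q t : C) n : (Cmod q < 1)%R -> (Cmod A <= Cmod B)%R ->
  (Cmod (bare_term A q t n) <= bare_term_bound B q t A n)%R.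
Proof.
  intros hq hAB. unfold bare_term, bare_term_bound, Cdiv.
  assert (H0 := qpoch_qq_neq0 q n hq).
  assert (Ht := Cmod_ge_0 t). assert (HA := Cmod_ge_0 A).
  assert (Hi : (0 < / (1 - Cmod q))%R) by (apply Rinv_0_lt_compat; lra).
  rewrite !Cmod_mult, Cmod_inv, Cmod_pow, Cmod_mult, Cmod_pow by exact H0.
  assert (B1 : (Cmod (qpoch A q n) <= exp (Cmod B / (1 - Cmod q)))%R).
  { eapply Rle_trans; [now apply qpoch_bound|]. apply exp_le_compat.
    apply Rmult_le_compat_r; lra. }
  assert (B2 : (/ Cmod (qpoch q q n) <= (/ (1 - Cmod q)) ^ n)%R).
  { rewrite pow_inv. apply Rinv_le_contravar; [apply pow_lt; lra|].
    now apply qpoch_qq_lower. }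
  assert (B2' : (0 < / Cmod (qpoch q q n))%R)
    by now apply Rinv_0_lt_compat, Cmod_gt_0.
  assert (B3 := node_prod_bound t q n hq).
  assert (B4 : (Cmod (qpoch_inf (A * q ^ S n * t) q)
                <= exp (Cmod B * Cmod t / (1 - Cmod q)))%R).
  { eapply Rle_trans; [now apply qpoch_inf_bound|]. apply exp_le_compat.
    apply Rmult_le_compat_r; [lra|]. rewrite !Cmod_mult.
    apply Rmult_le_compat_r; [lra|].
    assert (H1 := Cmod_pow_le1 q (S n) hq).
    assert (H2 := Cmod_ge_0 (q ^ S n)).
    apply Rle_trans with (Cmod A * 1)%R; [|lra].
    apply Rmult_le_compat_l; lra. }
  set (D := (Cmod A * Cmod q ^ n)%R).
  assert (HD : (0 <= D)%R).
  { apply Rmult_le_pos; [exact HA|apply pow_le, Cmod_ge_0]. }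
  replace (((1 + Cmod t) / (1 - Cmod q) * Cmod A * Cmod q ^ n) ^ n)%R
    with ((/ (1 - Cmod q)) ^ n * (1 + Cmod t) ^ n * D ^ n)%R
    by (unfold D, Rdiv; rewrite <- !Rpow_mult_distr; f_equal; ring).
  assert (E1 := exp_pos (Cmod B / (1 - Cmod q))).
  assert (E2 := exp_pos (Cmod B * Cmod t / (1 - Cmod q))).
  set (X1 := exp (Cmod B / _)) in *.
  set (X2 := exp (Cmod B * Cmod t / _)) in *.
  replace (X1 * X2 * ((/ (1 - Cmod q)) ^ n * (1 + Cmod t) ^ n * D ^ n))%R
    with (X1 * (/ (1 - Cmod q)) ^ n * (1 + Cmod t) ^ n * X2 * D ^ n)%R by ring.
  apply Rmult_le_compat_r; [now apply pow_le|].
  assert (P := Cmod_ge_0).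
  repeat apply Rmult_le_compat; auto; try lra.
  all: repeat apply Rmult_le_pos; auto; lra.
Qed.

Lemma ex_series_bare_term_bound B q t A : (Cmod q < 1)%R ->
  ex_series (bare_term_bound B q t A).
Proof.
  intros hq. unfold bare_term_bound.
  apply (ex_series_scal (V := R_NormedModule)).
  apply (ex_series_gauss ((1 + Cmod t) / (1 - Cmod q) * Cmod A) (Cmod q)).
  - assert (Ht := Cmod_ge_0 t).
    apply Rmult_le_pos; [|apply Cmod_ge_0].
    apply Rmult_le_pos; [lra|]. apply Rlt_le, Rinv_0_lt_compat; lra.
  - split; [apply Cmod_ge_0|exact hq].
Qed.

Lemma ex_series_mul_bare_term (A B q t : C) (u : nat -> C) (D : R) :
  (Cmod q < 1)%R -> (Cmod A <= Cmod B)%R -> (forall n, Cmod (u n) <= D)%R ->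
  ex_series (V := C_NormedModule) (fun n => u n * bare_term A q t n).
Proof.
  intros hq hAB hu.
  apply ex_series_Cmod with (fun n => (D * bare_term_bound B q t A n)%R).
  - intros n. rewrite Cmod_mult.
    apply Rmult_le_compat; try apply Cmod_ge_0; [apply hu|now apply bare_term_le].
  - apply (ex_series_scal (V := R_NormedModule)). now apply ex_series_bare_term_bound.
Qed.

Definition base_term (A q t : C) (n : nat) : C :=
  (1 - A * q ^ (2 * n)) * bare_term A q t n.

(** The contiguity A -> A q of the very-well-poised summand, with an
    explicit antidifference. It plays the role of the summation formula for
    6phi5, of which the sum for m = 0 is a limiting case. *)
Lemma base_term_telescope (A q t : C) n : (0 < Cmod q < 1)%R ->
  base_term A q t n - (1 - A) * base_term (A * q) q t n
  = (1 - q ^ n) * bare_term A q t n - (1 - q ^ S n) * bare_term A q t (S n).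
Proof.
  intros [q0 hq]. assert (hq0 : q <> 0) by now apply Cmod_gt_0.
  (* (A;q)_n (1 - A q^n) = (1 - A) (A q;q)_n avoids dividing by 1 - A *)
  assert (hs := qpoch_shift A q n). rewrite qpoch_S in hs.
  unfold base_term, bare_term.
  rewrite (qpoch_S A), (qpoch_S q). simpl node_prod.
  assert (hL := qpoch_inf_shift (A * q ^ S n * t) q hq).
  replace (A * q ^ S n * t * q) with (A * q ^ S (S n) * t) in hL
    by (rewrite !Cpow_S; ring).
  replace (A * q * q ^ S n * t) with (A * q ^ S (S n) * t)
    by (rewrite !Cpow_S; ring).
  rewrite hL.
  set (L := qpoch_inf (A * q ^ S (S n) * t) q).
  replace (2 * n)%nat with (n + n)%nat by lia.
  rewrite Cpow_add_r.
  replace ((A * q * q ^ n) ^ n) with ((A * q ^ n) ^ n * q ^ n)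
    by (rewrite !Cpow_mult_l; ring).
  replace ((A * q ^ S n) ^ S n) with ((A * q ^ n) ^ n * q ^ n * (A * q ^ S n))
    by (rewrite (Cpow_S _ n), !Cpow_S, !Cpow_mult_l; ring).
  assert (H := qpoch_qq_neq0 q n hq).
  assert (H' := one_sub_qpow_neq0 q n hq).
  rewrite !Cpow_S.
  replace ((1 - A) * ((1 - A * q * (q ^ n * q ^ n))
    * (qpoch (A * q) q n / qpoch q q n * node_prod t q n * L
       * ((A * q ^ n) ^ n * q ^ n))))
    with ((1 - A * q * (q ^ n * q ^ n))
    * ((1 - A) * qpoch (A * q) q n / qpoch q q n * node_prod t q n * L
       * ((A * q ^ n) ^ n * q ^ n))) by (field; exact H).
  rewrite <- hs.
  set (Z := (A * q ^ n) ^ n). clearbody Z. set (Q := q ^ n) in *.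
  field. split; assumption.
Qed.

Lemma base_coef_bound (A q : C) n : (Cmod q < 1)%R ->
  (Cmod (1 - A * q ^ n) <= 1 + Cmod A)%R.
Proof.
  intros hq. eapply Rle_trans; [apply Cmod_minus_le|].
  rewrite Cmod_1, Cmod_mult. apply Rplus_le_compat_l.
  assert (H := Cmod_pow_le1 q n hq). assert (HA := Cmod_ge_0 A).
  rewrite <- (Rmult_1_r (Cmod A)) at 2. now apply Rmult_le_compat_l.
Qed.

Definition base_sum (A q t : C) : C := Clim_seq (sum_n (base_term A q t)).

Lemma base_sum_correct (A q t : C) : (Cmod q < 1)%R ->
  is_series (V := C_NormedModule) (base_term A q t) (base_sum A q t).
Proof.
  intros hq. destruct (ex_series_mul_bare_term A A q t (fun n => 1 - A * q ^ (2 * n)) (1 + Cmod A)) as [l Hl].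
  - exact hq.
  - apply Rle_refl.
  - intros n; now apply base_coef_bound.
  - change (is_series (V := C_NormedModule) (base_term A q t) l) in Hl.
    replace (base_sum A q t) with l; [exact Hl|].
    symmetry; exact (filterlim_Clim_seq _ l Hl).
Qed.

Lemma telescope_remainder_lim (A q t : C) : (Cmod q < 1)%R ->
  filterlim (fun n => (1 - q ^ S n) * bare_term A q t (S n)) eventually
    (locally (T := C_NormedModule) (RtoC 0)).
Proof.
  intros hq. apply filterlim_C_iff.
  apply is_lim_seq_le_le with (fun _ => 0%R) (fun n => (2 * bare_term_bound A q t A (S n))%R).
  - intros n; split; [apply Cmod_ge_0|].
    replace (_ - 0) with ((1 - 1 * q ^ S n) * bare_term A q t (S n)) by ring.
    rewrite Cmod_mult. apply Rmult_le_compat; try apply Cmod_ge_0.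
    + eapply Rle_trans; [now apply base_coef_bound|]. rewrite Cmod_1; lra.
    + now apply bare_term_le, Rle_refl.
  - apply is_lim_seq_const.
  - replace (Finite 0) with (Rbar_mult 2%R 0%R) by (simpl; f_equal; ring).
    apply is_lim_seq_scal_l. apply -> is_lim_seq_incr_1.
    now apply ex_series_lim_0, ex_series_bare_term_bound.
Qed.

Lemma base_sum_shift (A q t : C) : (0 < Cmod q < 1)%R ->
  base_sum A q t = (1 - A) * base_sum (A * q) q t.
Proof.
  intros [q0 hq].
  assert (Hp : forall N, sum_n (base_term A q t) N
                         - (1 - A) * sum_n (base_term (A * q) q t) N
                       = (RtoC 0 - (1 - q ^ S N) * bare_term A q t (S N)) :> C).
  { assert (Hn := fun n => base_term_telescope A q t n (conj q0 hq)).
    induction N as [|N IH].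
    - rewrite !sum_O, Hn. change (q ^ 0) with (RtoC 1). ring.
    - rewrite !sum_Sn. change plus with Cplus.
      transitivity (0 - (1 - q ^ S N) * bare_term A q t (S N)
        + ((1 - q ^ S N) * bare_term A q t (S N)
           - (1 - q ^ S (S N)) * bare_term A q t (S (S N)))); [|ring].
      rewrite <- IH, <- Hn. ring. }
  assert (E : base_sum A q t - (1 - A) * base_sum (A * q) q t = 0 - 0).
  { apply (filterlim_C_unique (fun N => sum_n (base_term A q t) N
                         - (1 - A) * sum_n (base_term (A * q) q t) N)).
    - apply filterlim_C_sub; [now apply base_sum_correct|].
      apply filterlim_C_mult_l. now apply base_sum_correct.
    - apply (filterlim_ext (fun N => RtoC 0 - (1 - q ^ S N) * bare_term A q t (S N))).
      + intros N; now rewrite Hp.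
      + apply filterlim_C_sub; [apply filterlim_const|now apply telescope_remainder_lim]. }
  replace (base_sum A q t) with (base_sum A q t - (1 - A) * base_sum (A * q) q t
    + (1 - A) * base_sum (A * q) q t) by ring.
  rewrite E; ring.
Qed.

Lemma base_sum_iter (A q t : C) k : (0 < Cmod q < 1)%R ->
  base_sum A q t = qpoch A q k * base_sum (A * q ^ k) q t.
Proof.
  intros hq. induction k as [|k IH].
  - simpl. rewrite Cmult_1_r, Cmult_1_l; reflexivity.
  - rewrite IH, (base_sum_shift (A * q ^ k)), qpoch_S, Cpow_S by assumption.
    replace (A * (q * q ^ k)) with (A * q ^ k * q) by ring. ring.
Qed.

Lemma bare_term_bound_geom (A q t : C) k n : (Cmod q < 1)%R ->
  (bare_term_bound A q t (A * q ^ k) (S n)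
   <= Cmod q ^ k * bare_term_bound A q t A (S n))%R.
Proof.
  intros hq. unfold bare_term_bound. rewrite Cmod_mult, Cmod_pow.
  set (K := ((1 + Cmod t) / (1 - Cmod q))%R).
  set (M := (exp _ * exp _)%R).
  set (s := (Cmod q ^ k)%R). set (x := (K * Cmod A * Cmod q ^ S n)%R).
  replace (K * (Cmod A * s) * Cmod q ^ S n)%R with (s * x)%R by (unfold x; ring).
  rewrite Rpow_mult_distr. change (s ^ S n)%R with (s * s ^ n)%R.
  assert (hq0 := Cmod_ge_0 q).
  assert (s0 : (0 <= s)%R) by now apply pow_le.
  assert (s1 : (s <= 1)%R) by (unfold s; rewrite <- (pow1 k); apply pow_incr; lra).
  assert (sn : (s ^ n <= 1)%R) by (rewrite <- (pow1 n); apply pow_incr; lra).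
  assert (M0 : (0 < M)%R) by (apply Rmult_lt_0_compat; apply exp_pos).
  assert (K0 : (0 <= K)%R).
  { apply Rmult_le_pos; [assert (H := Cmod_ge_0 t); lra|].
    apply Rlt_le, Rinv_0_lt_compat; lra. }
  assert (x0 : (0 <= x ^ S n)%R).
  { apply pow_le. unfold x.
    apply Rmult_le_pos; [|now apply pow_le].
    apply Rmult_le_pos; [exact K0|apply Cmod_ge_0]. }
  assert (Y : (0 <= s * (M * x ^ S n))%R).
  { apply Rmult_le_pos; [exact s0|]. apply Rmult_le_pos; lra. }
  replace (M * (s * s ^ n * x ^ S n))%R with (s ^ n * (s * (M * x ^ S n)))%R by ring.
  rewrite <- (Rmult_1_l (s * (M * x ^ S n))) at 2.
  now apply Rmult_le_compat_r.
Qed.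

(** Along A q^k the terms with n >= 1 carry at least one factor q^k, so only
    the term n = 0 survives; it is (1 - A q^k) (A q^(k+1) t;q)_oo. *)
Lemma base_sum_geom_lim (A q t : C) : (0 < Cmod q < 1)%R ->
  filterlim (fun k => base_sum (A * q ^ k) q t) eventually
    (locally (T := C_NormedModule) (RtoC 1)).
Proof.
  intros [q0 hq]. assert (hq0 : q <> 0) by now apply Cmod_gt_0.
  destruct (ex_series_bare_term_bound A q t A hq) as [S0 HS0].
  destruct (proj1 (ex_series_incr_1 _) (ex_intro _ S0 HS0)) as [S1 HS1].
  clear S0 HS0.
  assert (Hk : forall k, (Cmod (A * q ^ k) <= Cmod A)%R).
  { intros k. rewrite Cmod_mult. rewrite <- (Rmult_1_r (Cmod A)) at 2.
    apply Rmult_le_compat_l; [apply Cmod_ge_0|now apply Cmod_pow_le1]. }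
  assert (Hrem : forall k,
    (Cmod (base_sum (A * q ^ k) q t - base_term (A * q ^ k) q t 0)
     <= (1 + Cmod A) * S1 * Cmod q ^ k)%R).
  { intros k.
    apply Cmod_series_le with (fun n => base_term (A * q ^ k) q t (S n))
      (fun n => (((1 + Cmod A) * Cmod q ^ k) * bare_term_bound A q t A (S n))%R).
    - intros n. unfold base_term. rewrite Cmod_mult, Rmult_assoc.
      apply Rmult_le_compat; try apply Cmod_ge_0.
      + eapply Rle_trans; [now apply base_coef_bound|]. specialize (Hk k); lra.
      + eapply Rle_trans; [|now apply bare_term_bound_geom].
        now apply bare_term_le.
    - apply (is_series_incr_1 (V := C_NormedModule) (base_term (A * q ^ k) q t)).
      replace (plus _ _) with (base_sum (A * q ^ k) q t)
        by (unfold plus; simpl; ring).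
      now apply base_sum_correct.
    - replace ((1 + Cmod A) * S1 * Cmod q ^ k)%R
        with ((1 + Cmod A) * Cmod q ^ k * S1)%R by ring.
      now apply (is_series_scal (V := R_NormedModule)). }
  assert (Hq : is_lim_seq (fun k => Cmod q ^ k)%R 0%R).
  { apply is_lim_seq_geom. rewrite Rabs_pos_eq; [exact hq|apply Cmod_ge_0]. }
  assert (H0 := qpoch_inf_geom_lim (A * q * t) q hq).
  apply filterlim_C_iff in H0. apply filterlim_C_iff.
  apply is_lim_seq_le_le with (fun _ => 0%R) (fun k =>
    ((1 + Cmod A) * S1 * Cmod q ^ k
     + ((1 + Cmod A) * Cmod (qpoch_inf (A * q * t * q ^ k) q - 1)
        + Cmod (A * q ^ k)))%R).
  - intros k; split; [apply Cmod_ge_0|].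
    set (L := qpoch_inf (A * q * t * q ^ k) q).
    (* base_term at n = 0 is (1 - A q^k) L *)
    replace (base_sum (A * q ^ k) q t - 1)
      with ((base_sum (A * q ^ k) q t - base_term (A * q ^ k) q t 0)
            + ((1 - A * q ^ k) * (L - 1) - A * q ^ k)).
    + eapply Rle_trans; [apply Cmod_triangle|].
      apply Rplus_le_compat; [apply Hrem|].
      eapply Rle_trans; [apply Cmod_minus_le|].
      apply Rplus_le_compat_r. rewrite Cmod_mult.
      apply Rmult_le_compat_r; [apply Cmod_ge_0|now apply base_coef_bound].
    + unfold base_term, bare_term. simpl.
      replace (A * q ^ k * (q * 1) * t) with (A * q * t * q ^ k) by ring.
      fold L. field.
  - apply is_lim_seq_const.
  - replace (Finite 0) with (Finite ((1 + Cmod A) * S1 * 0 + ((1 + Cmod A) * 0 + 0)))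
      by (f_equal; ring).
    apply is_lim_seq_plus'; [|apply is_lim_seq_plus'; [|now apply Cmod_geom_lim]].
    + now apply (is_lim_seq_scal_l _ _ (Finite 0)).
    + now apply (is_lim_seq_scal_l _ _ (Finite 0)).
Qed.

(** Both sides have the same recurrence in A -> A q and the same limit 1 as
    A tends to 0 along A q^k. To compare them, the sum at A is multiplied by
    the tail (A q^k;q)_oo. *)
Lemma base_sum_eq (A q t : C) : (0 < Cmod q < 1)%R ->
  base_sum A q t = qpoch_inf A q.
Proof.
  intros hq.
  assert (H1 := filterlim_C_mult_l (qpoch_inf A q) 1 _ (base_sum_geom_lim A q t hq)).
  assert (H2 := filterlim_C_mult_l (base_sum A q t) 1 _
                  (qpoch_inf_geom_lim A q (proj2 hq))).
  rewrite Cmult_1_r in H1, H2.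
  refine (filterlim_C_unique _ _ _ H2 (filterlim_ext _ _ _ H1)).
  intros k; cbv beta.
  rewrite (base_sum_iter A q t k hq), (qpoch_inf_split A q k) by apply hq. ring.
Qed.

(** * Induction on m *)

(** Solving the q-difference equation for the value at q x and absorbing the
    eigenvalue by [weight_shift] writes every term as the same linear
    combination of terms of three known series. Convergence is thus inherited.
    The factor 1 - x stays inside the third series because at x = 1 nothing is
    known about the series at x/q. *)
Lemma weighted_series_step (a q t x lx lx' : C) (ly : C) :
  (0 < Cmod q < 1)%R -> a <> 0 -> t <> 0 -> x <> 0 ->
  is_series (V := C_NormedModule)
    (fun n => weight (- a) q t n * qBessel n x a q) lx ->
  is_series (V := C_NormedModule)
    (fun n => weight (- a) q (t / q) n * qBessel n x a q) lx' ->
  is_series (V := C_NormedModule)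
    (fun n => (1 - x) * (weight (- a) q t n * qBessel n (x / q) a q)) ly ->
  is_series (V := C_NormedModule)
    (fun n => weight (- a) q t n * qBessel n (q * x) a q)
    (((a * x + 1 - x) / (a * x) + (t - 1) * (1 + a * t) / (a * t)) * lx
     + (- ((t - 1) / (a * t))) * lx' + (- / (a * x)) * ly).
Proof.
  intros hq ha ht hx Hx Hx' Hy.
  assert (hq0 : q <> 0) by now apply Cmod_gt_0.
  generalize (is_series_C_lin3 _ _ _
    ((a * x + 1 - x) / (a * x) + (t - 1) * (1 + a * t) / (a * t))
    (- ((t - 1) / (a * t))) (- / (a * x)) _ _ _ Hx Hx' Hy).
  apply is_series_C_ext; intros n. symmetry.
  assert (Hn := Cpow_nz q n hq0).
  assert (Hw := weight_shift (- a) q t n hq).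
  assert (Hb := qBessel_qdiff n x a q hq).
  set (y0 := qBessel n (q * x) a q) in *.
  set (y1 := qBessel n x a q) in *.
  set (y2 := qBessel n (x / q) a q) in *.
  set (w := weight (- a) q t n) in *.
  set (w' := weight (- a) q (t / q) n) in *.
  replace y0 with (a * x * y0 / (a * x)) by (field; tauto).
  rewrite Hb.
  replace (- ((t - 1) / (a * t)) * (w' * y1))
    with (- ((t - 1) * w' * y1 / (a * t))) by (field; tauto).
  rewrite Hw. field. tauto.
Qed.

(** The induction has to range over all nonzero t, since the step from m to
    m + 1 uses the identity for m both at t and at t/q. *)
Lemma weighted_series (a q : C) (m : nat) : (0 < Cmod q < 1)%R -> a <> 0 ->
  forall t : C, t <> 0 ->
  is_series (V := C_NormedModule)
    (fun n => weight (- a) q t n * qBessel n (q ^ m) a q)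
    (qpoch_inf (- a) q * t ^ m).
Proof.
  intros hq ha. assert (hq0 : q <> 0) by now apply Cmod_gt_0.
  induction m as [m IH] using (well_founded_induction Wf_nat.lt_wf).
  destruct m as [|m]; intros t ht.
  - rewrite Cmult_1_r, <- (base_sum_eq (- a) q t hq).
    generalize (base_sum_correct (- a) q t (proj2 hq)).
    apply is_series_C_ext; intros n.
    change (q ^ 0) with (RtoC 1). rewrite qBessel_at_1 by exact hq.
    unfold base_term, bare_term, weight.
    replace (- q ^ n * a) with (- a * q ^ n) by ring. ring.
  - assert (Hxn := Cpow_nz q m hq0).
    assert (Ht' : t / q <> 0).
    { intros E; apply ht. replace t with (t / q * q) by (field; exact hq0).
      rewrite E; ring. }
    assert (Hy : is_series (V := C_NormedModule)
      (fun n => (1 - q ^ m) * (weight (- a) q t n * qBessel n (q ^ m / q) a q))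
      ((1 - q ^ m) * (qpoch_inf (- a) q * (t ^ m / t)))).
    { destruct m as [|m].
      (* both the terms and the sum vanish, as 1 - q^0 = 0 *)
      - change (q ^ 0) with (RtoC 1).
        apply (is_series_C_ext
          (fun n => 0 * (weight (- a) q t n * qBessel n (q ^ 0) a q)));
          [intros n; ring|].
        replace ((1 - 1) * (qpoch_inf (- a) q * (t ^ 0 / t)))
          with (0 * (qpoch_inf (- a) q * t ^ 0)) by ring.
        apply (is_series_scal (V := C_NormedModule)).
        apply IH; [lia|exact ht].
      - apply (is_series_scal (V := C_NormedModule)).
        replace (q ^ S m / q) with (q ^ m) by (rewrite Cpow_S; field; exact hq0).
        replace (t ^ S m / t) with (t ^ m) by (rewrite Cpow_S; field; exact ht).
        apply IH; [lia|exact ht]. }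
    assert (H := weighted_series_step a q t (q ^ m) _ _ _ hq ha ht Hxn
      (IH m ltac:(lia) t ht) (IH m ltac:(lia) (t / q) Ht') Hy).
    rewrite (Cpow_S q).
    match type of H with is_series _ ?l =>
      replace (qpoch_inf (- a) q * t ^ S m) with l; [exact H|] end.
    replace ((t / q) ^ m) with (t ^ m / q ^ m)
      by (unfold Cdiv; rewrite Cpow_mult_l, Cpow_inv by exact hq0; reflexivity).
    rewrite Cpow_S. field. tauto.
Qed.

(** * The expansion of t^m *)

Lemma Cneq_inv_sub (x y : C) : y <> 0 -> x <> / y -> 1 - x * y <> 0.
Proof.
  intros hy hx H; apply hx.
  replace x with ((1 - (1 - x * y)) / y) by (field; exact hy).
  rewrite H. field. exact hy.
Qed.

Theorem theorem8p46 (q : C) (m : nat) (a t : C)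
    (hq : (0 < Cmod q < 1)%R)
    (ha0 : a <> 0) (ht0 : t <> 0)
    (ha : forall k : nat, - a <> / q ^ k)
    (hat : forall k : nat, - q * a * t <> / q ^ k) :
  is_series (V := C_NormedModule)
    (fun n : nat =>
       t ^ n * qpoch (- q * a) q (2 * n)
         * (qpoch (- a) q n * qpoch (1 / t) q n)
       / (qpoch (- a) q (2 * n) * (qpoch q q n * qpoch (- q * a * t) q n))
       * qBessel n (q ^ m) a q)
    (qpoch_inf (- q * a) q / qpoch_inf (- q * a * t) q * t ^ m).
Proof.
  assert (hq0 : q <> 0) by now apply Cmod_gt_0.
  assert (hq1 := proj2 hq).
  assert (hA : forall k, 1 - - a * q ^ k <> 0).
  { intros k; apply Cneq_inv_sub; [now apply Cpow_nz|apply ha]. }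
  assert (hT : forall k, 1 - - q * a * t * q ^ k <> 0).
  { intros k; apply Cneq_inv_sub; [now apply Cpow_nz|apply hat]. }
  assert (hA0 : 1 - - a <> 0).
  { specialize (hA 0%nat). now rewrite Cmult_1_r in hA. }
  assert (hL := qpoch_inf_neq0 _ q hq1 hT).
  assert (hEq : - a * q = - q * a) by ring.
  replace (qpoch_inf (- q * a) q / qpoch_inf (- q * a * t) q * t ^ m)
    with (/ ((1 - - a) * qpoch_inf (- q * a * t) q)
          * (qpoch_inf (- a) q * t ^ m)).
  2: { rewrite (qpoch_inf_shift (- a)), hEq by exact hq1. field. tauto. }
  generalize (is_series_scal (V := C_NormedModule)
    (/ ((1 - - a) * qpoch_inf (- q * a * t) q)) _ _
    (weighted_series a q m hq ha0 t ht0)).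
  apply is_series_C_ext; intros n.
  change scal with Cmult.
  unfold weight.
  replace (- a * q ^ S n * t) with (- q * a * t * q ^ n) by (rewrite Cpow_S; ring).
  assert (hs := qpoch_shift (- a) q (2 * n)).
  rewrite qpoch_S, hEq in hs.
  assert (hA2 := qpoch_neq0 (- a) q (2 * n) hA).
  assert (hTn := qpoch_neq0 (- q * a * t) q n hT).
  assert (hqn := qpoch_qq_neq0 q n hq1).
  rewrite <- (node_prod_qpoch t q n ht0).
  rewrite (qpoch_inf_split (- q * a * t) q n hq1) in hL |- *.
  assert (hLn : qpoch_inf (- q * a * t * q ^ n) q <> 0).
  { intros E; apply hL; rewrite E; ring. }
  replace (qpoch (- q * a) q (2 * n)) with
    (qpoch (- a) q (2 * n) * (1 - - a * q ^ (2 * n)) / (1 - - a))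
    by (rewrite hs; field; exact hA0).
  field. repeat split; assumption.
Qed.
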